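(* Let $d\in\mathbb N\cup\{\infty\}$ and let $Z=(Z_n)_{n\in\mathbb N}$ be a sequence in the NC unit ball $\mathcal B_d$. If $$\prod_{n\in\mathbb N}\rho_{NC}\big(Z_n,(Z_j)_{j\ne n}\big)>0,$$ then $Z$ is interpolating for $\mathcal H^\infty_d$.
   Context: For $m\ge1$, $\mathbb M^d_m$ is the set of $d$-tuples $X=(X^i)_i$ of complex $m\times m$ matrices (if $d=\infty$, with $\sum_iX^i(X^i)^*$ bounded), with the row norm topology, and $\mathbb M_d=\bigsqcup_{m\ge1}\mathbb M^d_m$. The NC unit ball is $\mathcal B_d=\{X\in\mathbb M_d : \|\sum_iX^i(X^i)^*\|<1\}$, with $\mathcal B_d(m)=\mathcal B_d\cap\mathbb M^d_m$; a set is open in $\mathbb M_d$ if each of its intersections with $\mathbb M^d_m$ is open. A function $f:\mathcal B_d\to\mathbb M_1$ is an NC function if it is graded ($X\in\mathcal B_d(m)\Rightarrow f(X)\in\mathbb M^1_m$), respects direct sums ($f(X\oplus Y)=f(X)\oplus f(Y)$), and respects similarities ($f(P^{-1}XP)=P^{-1}f(X)P$ for invertible $P$ whenever $P^{-1}XP\in\mathcal B_d$). It is holomorphic if locally bounded. $\mathcal H^\infty_d$ is the algebra of NC holomorphic functions $f$ on $\mathcal B_d$ with $\|f\|_\infty:=\sup_{X\in\mathcal B_d}\|f(X)\|<\infty$. $Z=(Z_n)$ in $\mathcal B_d$ (matrix sizes may vary with $n$) is interpolating for $\mathcal H^\infty_d$ if for every bounded sequence $(\phi_n)$ in $\mathcal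 H^\infty_d$ there is $\phi\in\mathcal H^\infty_d$ with $\phi(Z_n)=\phi_n(Z_n)$ for all $n$. For $W\in\mathcal B_d$ and a sequence $(W_j)_j$ in $\mathcal B_d$, $$\rho_{NC}(W,(W_j)_j):=\frac1{\inf\{\|\phi\|_\infty : \phi\in\mathcal H^\infty_d,\ \phi(W)=Id,\ \phi(W_j)=0\ \text{for all } j\}},$$ with value $0$ if no such $\phi$ exists. *)

(* Defs.v *)
From mathcomp Require Import all_boot all_order all_algebra.
From mathcomp Require Import all_classical all_reals all_analysis.
From mathcomp Require Import complex.

Set Implicit Arguments.
Unset Strict Implicit.
Unset Printing Implicit Defensive.

Import Order.TTheory GRing.Theory Num.Theory.
Import numFieldNormedType.Exports.

Local Open Scope classical_set_scope.
Local Open Scope ring_scope.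
Local Open Scope complex_scope.
Local Open Scope sesquilinear_scope.

Definition euclnorm (R : realType) (m : nat) (v : 'cV[R[i]]_m) : R :=
  Num.sqrt (\sum_(k < m) ComplexField.Normc.normc (v k 0) ^+ 2).

Definition opnorm (R : realType) (m : nat) (A : 'M[R[i]]_m) : R :=
  sup [set euclnorm (A *m v) | v in [set v : 'cV[R[i]]_m | euclnorm v <= 1]].

(* The number of variables d in N u {oo} is an [option nat]; [None] is oo. *)
Definition coord (d : option nat) : Type :=
  if d is Some n then 'I_n else nat.

Definition mxtuple (R : realType) (d : option nat) (m : nat) : Type :=
  coord d -> 'M[R[i]]_m.

Definition gram_partial (R : realType) (m : nat) (X : mxtuple R None m)
    (N : nat) : 'M[R[i]]_m :=
  \sum_(i < N) X i *m (X i) ^t*.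

(* The sum over i of X^i (X^i)^*.  The regular copy R[i]^o carries the
   topology of the modulus, and limits of matrices are entrywise; the limit
   exists as soon as the partial sums, which are increasing, are bounded. *)
Definition gram (R : realType) (d : option nat) (m : nat) :
    mxtuple R d m -> 'M[R[i]]_m :=
  match d return mxtuple R d m -> 'M[R[i]]_m with
  | Some n => fun X => \sum_(i < n) X i *m (X i) ^t*
  | None => fun X => limn (gram_partial X : nat -> 'M[R[i]^o]_m)
  end.

Definition gram_bounded (R : realType) (d : option nat) (m : nat) :
    mxtuple R d m -> Prop :=
  match d return mxtuple R d m -> Prop with
  | Some _ => fun _ => True
  | None => fun X => exists C : R, forall N, opnorm (gram_partial X N) <= C
  end.

Definition ncspace (R : realType) (d : option nat) (m : nat)
    (X : mxtuple R d m) : Prop :=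
  (0 < m)%N /\ gram_bounded X.

Definition ncball (R : realType) (d : option nat) (m : nat)
    (X : mxtuple R d m) : Prop :=
  ncspace X /\ opnorm (gram X) < 1.

Definition rownorm (R : realType) (d : option nat) (m : nat)
    (X : mxtuple R d m) : R :=
  Num.sqrt (opnorm (gram X)).

Definition subtuple (R : realType) (d : option nat) (m : nat)
    (X Y : mxtuple R d m) : mxtuple R d m := fun i => X i - Y i.

Definition dsum (R : realType) (d : option nat) (m n : nat)
    (X : mxtuple R d m) (Y : mxtuple R d n) : mxtuple R d (m + n) :=
  fun i => block_mx (X i) 0 0 (Y i).

Definition similar (R : realType) (d : option nat) (m : nat)
    (P : 'M[R[i]]_m) (X : mxtuple R d m) : mxtuple R d m :=
  fun i => invmx P *m X i *m P.

(* Disjoint union topology: U is a subset of the disjoint union of the levels,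
   given levelwise. *)
Definition nc_open (R : realType) (d : option nat)
    (U : forall m, mxtuple R d m -> Prop) : Prop :=
  forall m (X : mxtuple R d m), ncspace X -> U m X ->
    exists2 e : R, 0 < e &
      forall Y : mxtuple R d m, ncspace Y ->
        rownorm (subtuple Y X) < e -> U m Y.

(* Gradedness is built into the type.  Such maps are total, but only their
   values on the ball are ever used: values elsewhere are irrelevant. *)
Definition graded_map (R : realType) (d : option nat) : Type :=
  forall m, mxtuple R d m -> 'M[R[i]]_m.

Definition nc_function (R : realType) (d : option nat)
    (f : graded_map R d) : Prop :=
  (forall m n (X : mxtuple R d m) (Y : mxtuple R d n),
      ncball X -> ncball Y ->
      f _ (dsum X Y) = block_mx (f _ X) 0 0 (f _ Y)) /\
  (forall m (P : 'M[R[i]]_m) (X : mxtuple R d m),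
      P \in unitmx -> ncball X -> ncball (similar P X) ->
      f _ (similar P X) = invmx P *m f _ X *m P).

Definition locally_bounded (R : realType) (d : option nat)
    (f : graded_map R d) : Prop :=
  forall m (X : mxtuple R d m), ncball X ->
    exists U : forall k, mxtuple R d k -> Prop,
      [/\ nc_open U, U m X &
        exists C : R, forall k (Y : mxtuple R d k),
          ncball Y -> U k Y -> opnorm (f _ Y) <= C].

Definition nc_holomorphic (R : realType) (d : option nat)
    (f : graded_map R d) : Prop :=
  nc_function f /\ locally_bounded f.

Definition ball_norms (R : realType) (d : option nat)
    (f : graded_map R d) : set R :=
  [set r | exists m, exists2 X : mxtuple R d m, ncball X & r = opnorm (f _ X)].

Definition Hinfty (R : realType) (d : option nat) : set (graded_map R d) :=
  [set f | nc_holomorphic f /\ has_ubound (ball_norms f)].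

Definition hnorm (R : realType) (d : option nat) (f : graded_map R d) : R :=
  sup (ball_norms f).

Definition interpolating (R : realType) (d : option nat) (m : nat -> nat)
    (Z : forall n, mxtuple R d (m n)) : Prop :=
  forall phi_ : nat -> graded_map R d,
    (forall n, Hinfty (phi_ n)) ->
    (exists M : R, forall n, hnorm (phi_ n) <= M) ->
    exists2 phi : graded_map R d, Hinfty phi &
      forall n, phi _ (Z n) = phi_ n _ (Z n).

(* The family (W_j) is indexed by the j in J. *)
Definition separators (R : realType) (d : option nat) (k : nat)
    (W : mxtuple R d k) (m : nat -> nat) (J : set nat)
    (Wj : forall j, mxtuple R d (m j)) : set (graded_map R d) :=
  [set phi | [/\ Hinfty phi, phi _ W = 1%:M &
                 forall j, J j -> phi _ (Wj j) = 0]].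

Definition rho_nc (R : realType) (d : option nat) (k : nat)
    (W : mxtuple R d k) (m : nat -> nat) (J : set nat)
    (Wj : forall j, mxtuple R d (m j)) : R :=
  if `[< separators W J Wj !=set0 >]
  then (inf [set hnorm phi | phi in separators W J Wj])^-1
  else 0.

(* Main.v *)
Require Import Defs.
From mathcomp Require Import all_boot all_order all_algebra.
From mathcomp Require Import all_classical all_reals all_analysis.
From mathcomp Require Import complex ring lra.
Import Order.TTheory GRing.Theory Num.Theory.
Import numFieldNormedType.Exports.
Local Open Scope classical_set_scope.
Local Open Scope ring_scope.
Local Open Scope complex_scope.

Set Implicit Arguments.
Unset Strict Implicit.
Unset Printing Implicit Defensive.

(* Choose [r_n < rho_n] with positive product, and [psi_n] with
   [psi_n(Z_n) = Id], [psi_n(Z_j) = 0] for [j <> n] and [r_n ||psi_n|| <= 1].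
   For a contraction [F] and [0 < r < 1] put
     [h(F) = (1 - r) F (1 - r F)^-1],
     [k(F) = sqrt r (1 - F) (1 - r F)^-1].
   The identity [|1 - r z|^2 - r |1 - z|^2 - (1 - r)^2 |z|^2
   = (1 - r) (1 - |z|^2)] makes both the row [h k] and the column [h; k]
   contractions, while [h(0) = 0], [k(0) = sqrt r] and [h(r) = r / (1 + r)].
   With [F_n = r_n psi_n], the functions
     [A_n = k_0(F_0) ... k_{n-1}(F_{n-1}) h_n(F_n)],
     [B_n = h_n(F_n) k_{n-1}(F_{n-1}) ... k_0(F_0)]
   form a row contraction and a column contraction, vanish at [Z_j] for
   [j <> n], and both equal the scalar
   [c_n = (prod_{j<n} sqrt r_j) r_n / (1 + r_n)] at [Z_n], which is bounded
   away from [0].  Hence [phi = sum_n c_n^-2 A_n phi_n B_n] converges pointwise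
   to a bounded NC function that interpolates. *)

(** * Adjoints, the real inner product and squared norm bounds *)

Definition adj (R : realType) (m n : nat) (A : 'M[R[i]]_(m, n)) :
  'M[R[i]]_(n, m) := map_mx conjc A^T.

(** Keeping only the real part of the Hermitian product leaves every estimate in [R]; the imaginary
    part is recovered by pairing with a multiple by ['i]. *)
Definition rdot (R : realType) (m : nat) (u v : 'cV[R[i]]_m) : R :=
  complex.Re ((adj v *m u) 0 0).

(* The bound is on squares: [sqbound (C ^+ 2) A] means [opnorm A <= C]. *)
Definition sqbound (R : realType) (m : nat) (C : R) (A : 'M[R[i]]_m) : Prop :=
  forall v : 'cV[R[i]]_m, rdot (A *m v) (A *m v) <= C * rdot v v.

Lemma adjK (R : realType) (m n : nat) (A : 'M[R[i]]_(m, n)) : adj (adj A) = A.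
Proof. by apply/matrixP => i j; rewrite !mxE conjcK. Qed.

Lemma adjM (R : realType) (m n p : nat)
  (A : 'M[R[i]]_(m, n)) (B : 'M[R[i]]_(n, p)) :
  adj (A *m B) = adj B *m adj A.
Proof. by rewrite /adj trmx_mul map_mxM. Qed.

Lemma adjB (R : realType) (m n : nat) (A B : 'M[R[i]]_(m, n)) :
  adj (A - B) = adj A - adj B.
Proof. by rewrite /adj linearB /= map_mxB. Qed.

Lemma adjZ (R : realType) (m n : nat) (a : R) (A : 'M[R[i]]_(m, n)) :
  adj (a%:C *: A) = a%:C *: adj A.
Proof.
by rewrite /adj linearZ /= map_mxZ; congr (_ *: _); exact: conjc_real.
Qed.

Lemma adj1 (R : realType) (m : nat) : adj 1%:M = 1%:M :> 'M[R[i]]_m.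
Proof. by rewrite /adj trmx1 map_mx1. Qed.

Lemma adj_inv (R : realType) (m : nat) (A : 'M[R[i]]_m) :
  adj (invmx A) = invmx (adj A).
Proof. by rewrite /adj trmx_inv map_invmx. Qed.

Lemma rdotE (R : realType) (m : nat) (u v : 'cV[R[i]]_m) :
  rdot u v = \sum_k (complex.Re (u k 0) * complex.Re (v k 0) +
                     complex.Im (u k 0) * complex.Im (v k 0)).
Proof.
rewrite /rdot mxE (raddf_sum (@complex.Re R : Rcomplex R -> R)) /=.
apply: eq_bigr => k _; rewrite !mxE.
by case: (u k 0) => a b; case: (v k 0) => c e /=; ring.
Qed.

Lemma rdot_adj (R : realType) (m : nat) (A : 'M[R[i]]_m) (u v : 'cV[R[i]]_m) :
  rdot (A *m u) v = rdot u (adj A *m v).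
Proof. by rewrite /rdot adjM adjK mulmxA. Qed.

Lemma rdotDl (R : realType) (m : nat) (u v w : 'cV[R[i]]_m) :
  rdot (u + v) w = rdot u w + rdot v w.
Proof.
rewrite !rdotE -big_split; apply: eq_bigr => k _.
by rewrite !mxE !raddfD /=; ring.
Qed.

Lemma rdot0l (R : realType) (m : nat) (w : 'cV[R[i]]_m) : rdot 0 w = 0.
Proof. by rewrite rdotE big1 // => k _; rewrite !mxE /= !mul0r addr0. Qed.

Lemma rdot_suml (R : realType) (m N : nat) (u : nat -> 'cV[R[i]]_m)
    (w : 'cV[R[i]]_m) :
  rdot (\sum_(0 <= n < N) u n) w = \sum_(0 <= n < N) rdot (u n) w.
Proof.
elim: N => [|N IH]; first by rewrite !big_nil rdot0l.
by rewrite !big_nat_recr //= rdotDl IH.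
Qed.

Lemma rdot_ge0 (R : realType) (m : nat) (v : 'cV[R[i]]_m) : 0 <= rdot v v.
Proof.
by rewrite rdotE; apply: sumr_ge0 => k _; rewrite addr_ge0 // -expr2 sqr_ge0.
Qed.

Lemma rdot_eq0 (R : realType) (m : nat) (v : 'cV[R[i]]_m) :
  rdot v v <= 0 -> v = 0.
Proof.
move=> v0; have {}v0 : rdot v v = 0 by apply/eqP; rewrite eq_le v0 rdot_ge0.
apply/matrixP => k j; rewrite ord1 mxE.
move: v0; rewrite rdotE => /eqP; rewrite psumr_eq0; last first.
  by move=> i _; rewrite addr_ge0 // -expr2 sqr_ge0.
move=> /allP /(_ k); rewrite mem_index_enum => /(_ isT) /=.
case: (v k 0) => a b /=; rewrite -!expr2 paddr_eq0 ?sqr_ge0 // !sqrf_eq0.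
by move=> /andP[/eqP-> /eqP->].
Qed.

Lemma rdotZ (R : realType) (m : nat) (a : R) (v : 'cV[R[i]]_m) :
  rdot (a%:C *: v) (a%:C *: v) = a ^+ 2 * rdot v v.
Proof.
rewrite !rdotE mulr_sumr; apply: eq_bigr => k _; rewrite !mxE.
by case: (v k 0) => b c /=; ring.
Qed.

Lemma rdotC (R : realType) (m : nat) (u v : 'cV[R[i]]_m) : rdot u v = rdot v u.
Proof. by rewrite !rdotE; apply: eq_bigr => k _; ring. Qed.

Lemma rdotNl (R : realType) (m : nat) (u v : 'cV[R[i]]_m) :
  rdot (- u) v = - rdot u v.
Proof.
rewrite !rdotE -sumrN; apply: eq_bigr => k _.
by rewrite !mxE !raddfN /=; ring.
Qed.

Lemma rdotDD (R : realType) (m : nat) (u v : 'cV[R[i]]_m) :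
  rdot (u + v) (u + v) = rdot u u + 2 * rdot u v + rdot v v.
Proof. by rewrite rdotDl ![rdot _ (u + v)]rdotC !rdotDl (rdotC v u); ring. Qed.

(** Positivity of the squared norms of [u + v] and [- u + v]. This takes the place of Cauchy-Schwarz
    in the estimates below. *)
Lemma rdot_amgm (R : realType) (m : nat) (u v : 'cV[R[i]]_m) :
  `|rdot u v| <= (rdot u u + rdot v v) / 2.
Proof.
have := rdot_ge0 (u + v); have := rdot_ge0 (- u + v).
rewrite !rdotDD !rdotNl (rdotC u (- u)) rdotNl ler_norml => h1 h2.
by apply/andP; split; lra.
Qed.

(** With [w = adj A *m v], the arithmetic-geometric inequality for [rdot (A *m w) v = |w|^2] gives
    [|w|^2 <= (|w|^2 + |v|^2) / 2]. *)
Lemma sqbound_adj (R : realType) (m : nat) (A : 'M[R[i]]_m) :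
  sqbound 1 A -> sqbound 1 (adj A).
Proof.
move=> hA v; rewrite mul1r.
have := hA (adj A *m v); rewrite mul1r => h1.
have := le_trans (ler_norm _) (rdot_amgm (A *m (adj A *m v)) v).
rewrite rdot_adj => h2; lra.
Qed.

(** * The functions [h] and [k] of one contraction *)

Lemma unitmx_inj (K : fieldType) (m : nat) (A : 'M[K]_m) :
  (forall v : 'cV[K]_m, A *m v = 0 -> v = 0) -> A \in unitmx.
Proof.
move=> hA; rewrite -unitmx_tr -row_free_unit -kermx_eq0.
apply/eqP/row_matrixP => i.
apply: trmx_inj; rewrite row0 trmx0; apply: hA.
by rewrite -[X in X *m _]trmxK -trmx_mul -row_mul mulmx_ker row0 trmx0.
Qed.

(** A kernel vector satisfies [v = r F v], so [|F v|^2 <= |v|^2 = r^2 |F v|^2], which forces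
    [F v = 0] and then [v = 0]. *)
Lemma resolvent_unit (R : realType) (m : nat) (r : R) (F : 'M[R[i]]_m) :
  0 < r < 1 -> sqbound 1 F -> 1%:M - r%:C *: F \in unitmx.
Proof.
move=> /andP[r0 r1] hF; apply: unitmx_inj => v.
rewrite mulmxBl mul1mx -scalemxAl => /eqP; rewrite subr_eq0 => /eqP hv.
apply: rdot_eq0; have := hF v; rewrite mul1r => h.
have hr : rdot v v = r ^+ 2 * rdot (F *m v) (F *m v) by rewrite -rdotZ -hv.
have r2 : 0 < 1 - r ^+ 2 by nra.
have p0 : rdot (F *m v) (F *m v) <= 0.
  by rewrite -(pmulr_rle0 _ r2) mulrBl mul1r -hr subr_le0.
by rewrite hr mulr_ge0_le0 // sqr_ge0.
Qed.

Definition hmx (R : realType) (m : nat) (r : R) (F : 'M[R[i]]_m) : 'M[R[i]]_m :=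
  (1 - r)%:C *: (F *m invmx (1%:M - r%:C *: F)).

Definition kmx (R : realType) (m : nat) (r : R) (F : 'M[R[i]]_m) : 'M[R[i]]_m :=
  (Num.sqrt r)%:C *: ((1%:M - F) *m invmx (1%:M - r%:C *: F)).

(** Substituting [v = (1 - r F) w] clears the resolvents. The cross terms cancel, and the right side
    exceeds the left by [(1 - r) (|w|^2 - |F w|^2)]. *)
Lemma hkmx_contraction (R : realType) (m : nat) (r : R) (F : 'M[R[i]]_m)
    (v : 'cV[R[i]]_m) :
  0 < r < 1 -> sqbound 1 F ->
  rdot (hmx r F *m v) (hmx r F *m v) + rdot (kmx r F *m v) (kmx r F *m v)
    <= rdot v v.
Proof.
move=> r01 hF; have hu := resolvent_unit r01 hF; case/andP: r01 => r0 r1.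
rewrite /hmx /kmx -!scalemxAl !rdotZ -!mulmxA sqr_sqrtr ?(ltW r0)//.
set w := invmx _ *m v.
have {1 2}-> : v = w - r%:C *: (F *m w).
  by rewrite scalemxAl -[X in X - _]mul1mx -mulmxBl /w mulKVmx.
rewrite mulmxBl mul1mx !rdotDD !rdotNl !(rdotC w (- _)) !rdotNl.
rewrite !(rdotC _ (- _)) !rdotNl rdotZ.
have -> : rdot (r%:C *: (F *m w)) w = r * rdot (F *m w) w.
  rewrite !rdotE mulr_sumr; apply: eq_bigr => k _; rewrite !mxE.
  by case: (\sum_ _ _) => b c /=; ring.
have := hF w; rewrite mul1r; nra.
Qed.

(** * Intertwining relations [T F1 = F2 T], which serve for both similarities and direct sums *)

Lemma invmx_intertwine (K : comUnitRingType) (m n : nat) (G1 : 'M[K]_m)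
    (G2 : 'M[K]_n) (T : 'M[K]_(n, m)) :
  G1 \in unitmx -> G2 \in unitmx -> T *m G1 = G2 *m T ->
  T *m invmx G1 = invmx G2 *m T.
Proof.
move=> u1 u2 h; rewrite -[T in LHS](mulKmx u2) -h -!mulmxA.
by rewrite mulmxV // mulmx1.
Qed.

Lemma pencil_intertwine (K : comUnitRingType) (m n : nat) (a : K)
    (F1 : 'M[K]_m) (F2 : 'M[K]_n) (T : 'M[K]_(n, m)) :
  T *m F1 = F2 *m T -> T *m (1%:M - a *: F1) = (1%:M - a *: F2) *m T.
Proof.
by move=> h; rewrite mulmxBr mulmxBl mulmx1 mul1mx -scalemxAr -scalemxAl h.
Qed.

Lemma hmx_intertwine (R : realType) (m n : nat) (r : R) (F1 : 'M[R[i]]_m)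
    (F2 : 'M[R[i]]_n) (T : 'M[R[i]]_(n, m)) :
  0 < r < 1 -> sqbound 1 F1 -> sqbound 1 F2 -> T *m F1 = F2 *m T ->
  T *m hmx r F1 = hmx r F2 *m T.
Proof.
move=> r01 h1 h2 h.
have := invmx_intertwine (resolvent_unit r01 h1) (resolvent_unit r01 h2)
  (pencil_intertwine r%:C h) => hG.
by rewrite /hmx -scalemxAr -scalemxAl mulmxA h -!mulmxA hG.
Qed.

Lemma kmx_intertwine (R : realType) (m n : nat) (r : R) (F1 : 'M[R[i]]_m)
    (F2 : 'M[R[i]]_n) (T : 'M[R[i]]_(n, m)) :
  0 < r < 1 -> sqbound 1 F1 -> sqbound 1 F2 -> T *m F1 = F2 *m T ->
  T *m kmx r F1 = kmx r F2 *m T.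
Proof.
move=> r01 h1 h2 h.
have := invmx_intertwine (resolvent_unit r01 h1) (resolvent_unit r01 h2)
  (pencil_intertwine r%:C h) => hG.
have := pencil_intertwine 1 h; rewrite !scale1r => h'.
by rewrite /kmx -scalemxAr -scalemxAl mulmxA h' -!mulmxA hG.
Qed.

(** The adjoint reverses the product, and the order is restored because [F] commutes with its
    resolvent. *)
Lemma adj_hmx (R : realType) (m : nat) (r : R) (F : 'M[R[i]]_m) :
  0 < r < 1 -> sqbound 1 F -> adj (hmx r F) = hmx r (adj F).
Proof.
move=> r01 hF; have hu := resolvent_unit r01 hF.
have hc := invmx_intertwine hu hu (pencil_intertwine r%:C (erefl (F *m F))).
by rewrite /hmx hc adjZ adjM adj_inv adjB adj1 adjZ.
Qed.

Lemma adj_kmx (R : realType) (m : nat) (r : R) (F : 'M[R[i]]_m) :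
  0 < r < 1 -> sqbound 1 F -> adj (kmx r F) = kmx r (adj F).
Proof.
move=> r01 hF; have hu := resolvent_unit r01 hF.
have h1 : (1%:M - F) *m F = F *m (1%:M - F).
  by rewrite mulmxBl mulmxBr mul1mx mulmx1.
have hc := invmx_intertwine hu hu (pencil_intertwine r%:C h1).
by rewrite /kmx hc adjZ adjM adj_inv !adjB adj1 adjZ.
Qed.

Lemma hmx0 (R : realType) (m : nat) (r : R) : hmx r (0 : 'M[R[i]]_m) = 0.
Proof. by rewrite /hmx mul0mx scaler0. Qed.

Lemma kmx0 (R : realType) (m : nat) (r : R) :
  kmx r (0 : 'M[R[i]]_m) = (Num.sqrt r)%:C%:M.
Proof. by rewrite /kmx scaler0 !subr0 invmx1 mulmx1 scalemx1. Qed.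

(** This is [(1 - r) r / (1 - r^2)], simplified; it gives the value of [h] at the node where [F]
    equals [r]. *)
Lemma hmx_scalar (R : realType) (m : nat) (r : R) :
  0 < r < 1 -> hmx r (r%:C%:M : 'M[R[i]]_m) = (r / (1 + r))%:C%:M.
Proof.
move=> /andP[r0 r1]; rewrite /hmx scale_scalar_mx -raddfB /= invmx_scalar.
rewrite -scalar_mxM scale_scalar_mx; congr (_%:M).
rewrite -(rmorph1 (real_complex R)) -!rmorphM -rmorphB /= -fmorphV -!rmorphM /=.
congr (_%:C); have : 1 - r * r != 0 by rewrite lt0r_neq0 //; nra.
have : 1 + r != 0 by rewrite lt0r_neq0 //; lra.
by move=> h1 h2; field; rewrite h1 h2.
Qed.

(** * The row and column contractions and the terms built from them *)

Fixpoint kleft (R : realType) (m : nat) (r : nat -> R) (F : nat -> 'M[R[i]]_m)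
    (n : nat) : 'M[R[i]]_m :=
  if n is p.+1 then kleft r F p *m kmx (r p) (F p) else 1%:M.

Fixpoint kright (R : realType) (m : nat) (r : nat -> R) (F : nat -> 'M[R[i]]_m)
    (n : nat) : 'M[R[i]]_m :=
  if n is p.+1 then kmx (r p) (F p) *m kright r F p else 1%:M.

Definition rowfun (R : realType) (m : nat) (r : nat -> R)
    (F : nat -> 'M[R[i]]_m) (n : nat) : 'M[R[i]]_m :=
  kleft r F n *m hmx (r n) (F n).

Definition colfun (R : realType) (m : nat) (r : nat -> R)
    (F : nat -> 'M[R[i]]_m) (n : nat) : 'M[R[i]]_m :=
  hmx (r n) (F n) *m kright r F n.

Lemma colfun_contraction (R : realType) (m : nat) (r : nat -> R)
    (F : nat -> 'M[R[i]]_m) (N : nat) (v : 'cV[R[i]]_m) :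
  (forall n, 0 < r n < 1) -> (forall n, sqbound 1 (F n)) ->
  \sum_(0 <= n < N) rdot (colfun r F n *m v) (colfun r F n *m v) <= rdot v v.
Proof.
move=> hr hF.
(* Keeping the remainder [kright r F N *m v] makes the induction telescope: each step splits it into
   the next column entry and the next remainder. *)
suff : \sum_(0 <= n < N) rdot (colfun r F n *m v) (colfun r F n *m v)
    + rdot (kright r F N *m v) (kright r F N *m v) <= rdot v v.
  have := rdot_ge0 (kright r F N *m v); lra.
elim: N => [|N IH]; first by rewrite big_nil add0r /= mul1mx.
rewrite big_nat_recr //= -addrA; apply: le_trans IH; rewrite lerD2l.
by have := hkmx_contraction (kright r F N *m v) (hr N) (hF N); rewrite !mulmxA.
Qed.

(** Turns the row estimate into the column estimate for the adjoint contractions. *)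
Lemma adj_rowfun (R : realType) (m : nat) (r : nat -> R)
    (F : nat -> 'M[R[i]]_m) (n : nat) :
  (forall n, 0 < r n < 1) -> (forall n, sqbound 1 (F n)) ->
  adj (rowfun r F n) = colfun r (fun j => adj (F j)) n.
Proof.
move=> hr hF; rewrite /rowfun /colfun adjM adj_hmx //; congr (_ *m _).
by elim: n => [|n IH] /=; rewrite ?adj1 // adjM adj_kmx // IH.
Qed.

(** The factor [c_n^-2] of the series is absorbed into [D n]. *)
Definition ncterm (R : realType) (m : nat) (r : nat -> R)
    (F D : nat -> 'M[R[i]]_m) (n : nat) : 'M[R[i]]_m :=
  rowfun r F n *m D n *m colfun r F n.

Lemma kleft_intertwine (R : realType) (m n : nat) (r : nat -> R)
    (F1 : nat -> 'M[R[i]]_m) (F2 : nat -> 'M[R[i]]_n)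
    (T : 'M[R[i]]_(n, m)) (k : nat) :
  (forall j, 0 < r j < 1) -> (forall j, sqbound 1 (F1 j)) ->
  (forall j, sqbound 1 (F2 j)) -> (forall j, T *m F1 j = F2 j *m T) ->
  T *m kleft r F1 k = kleft r F2 k *m T.
Proof.
move=> hr h1 h2 h; elim: k => [|k IH] /=; first by rewrite mulmx1 mul1mx.
by rewrite mulmxA IH -!mulmxA (kmx_intertwine (F2 := F2 k)).
Qed.

Lemma kright_intertwine (R : realType) (m n : nat) (r : nat -> R)
    (F1 : nat -> 'M[R[i]]_m) (F2 : nat -> 'M[R[i]]_n)
    (T : 'M[R[i]]_(n, m)) (k : nat) :
  (forall j, 0 < r j < 1) -> (forall j, sqbound 1 (F1 j)) ->
  (forall j, sqbound 1 (F2 j)) -> (forall j, T *m F1 j = F2 j *m T) ->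
  T *m kright r F1 k = kright r F2 k *m T.
Proof.
move=> hr h1 h2 h; elim: k => [|k IH] /=; first by rewrite mulmx1 mul1mx.
by rewrite mulmxA (kmx_intertwine (F2 := F2 k)) // -!mulmxA IH.
Qed.

Lemma ncterm_intertwine (R : realType) (m n : nat) (r : nat -> R)
    (F1 D1 : nat -> 'M[R[i]]_m) (F2 D2 : nat -> 'M[R[i]]_n)
    (T : 'M[R[i]]_(n, m)) (k : nat) :
  (forall j, 0 < r j < 1) -> (forall j, sqbound 1 (F1 j)) ->
  (forall j, sqbound 1 (F2 j)) -> (forall j, T *m F1 j = F2 j *m T) ->
  (forall j, T *m D1 j = D2 j *m T) ->
  T *m ncterm r F1 D1 k = ncterm r F2 D2 k *m T.
Proof.
move=> hr h1 h2 h hD; have e1 := kleft_intertwine k hr h1 h2 h.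
have e2 := hmx_intertwine (hr k) (h1 k) (h2 k) (h k).
have e3 := kright_intertwine k hr h1 h2 h.
rewrite /ncterm /rowfun /colfun !mulmxA e1 -!mulmxA; congr (_ *m _).
rewrite !mulmxA e2 -!mulmxA; congr (_ *m _).
rewrite !mulmxA hD -!mulmxA; congr (_ *m _).
by rewrite !mulmxA e2 -!mulmxA e3.
Qed.

(** Moving the row factor across the pairing and using [rdot_amgm] bounds each term by half of
    [C |B_n u|^2 + |A_n^* v|^2]. Both families are columns of contractions, so the sums are at most
    [C |u|^2] and [|v|^2]. *)
Lemma ncterm_dot_summable (R : realType) (m : nat) (r : nat -> R) (C : R)
    (F D : nat -> 'M[R[i]]_m) (N : nat) (u v : 'cV[R[i]]_m) :
  (forall n, 0 < r n < 1) -> (forall n, sqbound 1 (F n)) -> 0 <= C ->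
  (forall n, sqbound C (D n)) ->
  \sum_(0 <= n < N) `|rdot (ncterm r F D n *m u) v|
    <= (C * rdot u u + rdot v v) / 2.
Proof.
move=> hr hF C0 hD.
have hcu := colfun_contraction N u hr hF.
have hcv := colfun_contraction N v hr (fun n => sqbound_adj (hF n)).
set su := \sum_(0 <= n < N) _ in hcu.
set sv := \sum_(0 <= n < N) _ in hcv.
apply: (@le_trans _ _ ((C * su + sv) / 2)); last first.
  by rewrite ler_pM2r ?invr_gt0 // lerD // ler_wpM2l.
rewrite /su /sv mulr_sumr -big_split /= mulr_suml; apply: ler_sum => n _.
rewrite /ncterm -2!mulmxA rdot_adj adj_rowfun //.
apply: le_trans (rdot_amgm _ _) _; rewrite ler_pM2r ?invr_gt0 // lerD2r.
exact: hD.
Qed.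

(* Pairing [L u] with itself makes the two contractions bound
   [|L u|^2] by [(C |u|^2 + |L u|^2) / 2]. *)
Lemma ncterm_sum_bound (R : realType) (m : nat) (r : nat -> R) (C : R)
    (F D : nat -> 'M[R[i]]_m) (N : nat) :
  (forall n, 0 < r n < 1) -> (forall n, sqbound 1 (F n)) -> 0 <= C ->
  (forall n, sqbound C (D n)) ->
  sqbound C (\sum_(0 <= n < N) ncterm r F D n).
Proof.
move=> hr hF C0 hD u.
set w := _ *m u.
have := ncterm_dot_summable N u w hr hF C0 hD.
have : rdot w w <= \sum_(0 <= n < N) `|rdot (ncterm r F D n *m u) w|.
  rewrite {1}/w mulmx_suml rdot_suml.
  by apply: ler_sum => n _; exact: ler_norm.
lra.
Qed.

(** * Entrywise convergence of matrices *)

Lemma cvgn_sum (R : realType) (p : nat) (f : 'I_p -> nat -> R) (l : 'I_p -> R) :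
  (forall k, f k n @[n --> \oo] --> l k) ->
  \sum_k f k n @[n --> \oo] --> \sum_k l k.
Proof.
by move=> h; apply: (cvg_big (op := +%R) (x0 := 0)) => //; exact: add_continuous.
Qed.

Definition mxcvg (R : realType) (m n : nat) (S : nat -> 'M[R[i]]_(m, n))
    (L : 'M[R[i]]_(m, n)) : Prop :=
  forall i j, (complex.Re (S k i j) @[k --> \oo] --> complex.Re (L i j)) /\
              (complex.Im (S k i j) @[k --> \oo] --> complex.Im (L i j)).

(** Total: [limn] returns a default value at a divergent coordinate, so facts about [mxlim] go
    through [mxcvg]. *)
Definition mxlim (R : realType) (m n : nat) (S : nat -> 'M[R[i]]_(m, n)) :
    'M[R[i]]_(m, n) :=
  \matrix_(i, j) (limn (fun k => complex.Re (S k i j)) +i*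
                  limn (fun k => complex.Im (S k i j)))%C.

Lemma mxcvg_lim (R : realType) (m n : nat) (S : nat -> 'M[R[i]]_(m, n)) L :
  mxcvg S L -> mxlim S = L.
Proof.
move=> h; apply/matrixP => i j; rewrite mxE; have [h1 h2] := h i j.
rewrite (cvg_lim _ h1) // (cvg_lim _ h2) //.
by case: (L i j).
Qed.

Lemma mxcvg_near (R : realType) (m n : nat) (S : nat -> 'M[R[i]]_(m, n)) L N :
  (forall k, (N <= k)%N -> S k = L) -> mxcvg S L.
Proof.
move=> h i j; split; apply: cvg_near_cst;
  by exists N => // k /= Nk; rewrite h.
Qed.

Lemma mxcvg_mull (R : realType) (m n p : nat) (S : nat -> 'M[R[i]]_(m, n)) L
    (T : 'M[R[i]]_(p, m)) :
  mxcvg S L -> mxcvg (fun k => T *m S k) (T *m L).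
Proof.
move=> h i j.
have hRe (A : 'M[R[i]]_(m, n)) : complex.Re ((T *m A) i j) =
    \sum_l (complex.Re (T i l) * complex.Re (A l j)
            - complex.Im (T i l) * complex.Im (A l j)).
  rewrite mxE (raddf_sum (@complex.Re R : Rcomplex R -> R)).
  by apply: eq_bigr => l _; case: (T i l) => a b; case: (A l j).
have hIm (A : 'M[R[i]]_(m, n)) : complex.Im ((T *m A) i j) =
    \sum_l (complex.Re (T i l) * complex.Im (A l j)
            + complex.Im (T i l) * complex.Re (A l j)).
  rewrite mxE (raddf_sum (@complex.Im R : Rcomplex R -> R)).
  by apply: eq_bigr => l _; case: (T i l) => a b; case: (A l j).
split.
  rewrite hRe; under eq_fun do rewrite hRe.
  apply: cvgn_sum => l; have [h1 h2] := h l j.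
  by apply: cvgB; apply: cvgMr.
rewrite hIm; under eq_fun do rewrite hIm.
apply: cvgn_sum => l; have [h1 h2] := h l j.
by apply: cvgD; apply: cvgMr.
Qed.

Lemma mxcvg_tr (R : realType) (m n : nat) (S : nat -> 'M[R[i]]_(m, n)) L :
  mxcvg S L -> mxcvg (fun k => (S k)^T) L^T.
Proof.
move=> h i j; rewrite mxE; have [h1 h2] := h j i.
by split; under eq_fun do rewrite mxE.
Qed.

Lemma mxcvg_mulr (R : realType) (m n p : nat) (S : nat -> 'M[R[i]]_(m, n)) L
    (T : 'M[R[i]]_(n, p)) :
  mxcvg S L -> mxcvg (fun k => S k *m T) (L *m T).
Proof.
move=> /mxcvg_tr/(mxcvg_mull T^T)/mxcvg_tr; rewrite -trmx_mul trmxK => h.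
by move: h; under eq_fun do rewrite -trmx_mul trmxK.
Qed.

Lemma mxcvg_rdot (R : realType) (m : nat) (u : nat -> 'cV[R[i]]_m) v :
  mxcvg u v -> rdot (u k) (u k) @[k --> \oo] --> rdot v v.
Proof.
move=> h; rewrite rdotE; under eq_fun do rewrite rdotE.
apply: cvgn_sum => l; have [h1 h2] := h l 0.
by apply: cvgD; apply: cvgM.
Qed.

Lemma mxcvg_sqbound (R : realType) (m : nat) (C : R) (S : nat -> 'M[R[i]]_m) L :
  mxcvg S L -> (forall k, sqbound C (S k)) -> sqbound C L.
Proof.
move=> h hS v; apply: cvgr_to_le (mxcvg_rdot (mxcvg_mulr v h)) _.
by apply: nearW => k; exact: hS.
Qed.

(** Pairings with basis vectors read off the entries, so convergence of all pairings yields
    entrywise convergence. *)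
Lemma rdot_delta_Re (R : realType) (m : nat) (A : 'M[R[i]]_m) i j :
  rdot (A *m delta_mx j 0) (delta_mx i 0) = complex.Re (A i j).
Proof.
rewrite -colE rdotE (bigD1 i) //= big1 => [|k ki];
  rewrite !mxE ?eqxx ?(negbTE ki) /=.
  by rewrite mulr1 mulr0 !addr0.
by rewrite !mulr0 addr0.
Qed.

Lemma rdot_delta_Im (R : realType) (m : nat) (A : 'M[R[i]]_m) i j :
  rdot (A *m delta_mx j 0) ('i%C *: delta_mx i 0) = complex.Im (A i j).
Proof.
rewrite -colE rdotE (bigD1 i) //= big1 => [|k ki];
  rewrite !mxE ?eqxx ?(negbTE ki) /=; ring.
Qed.

(** * The sum of the series: existence, bound, intertwining and direct sums *)

Definition ncsum (R : realType) (m : nat) (r : nat -> R)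
    (F D : nat -> 'M[R[i]]_m) (N : nat) : 'M[R[i]]_m :=
  \sum_(0 <= n < N) ncterm r F D n.

Lemma ncsum_dot_cvg (R : realType) (m : nat) (r : nat -> R) (C : R)
    (F D : nat -> 'M[R[i]]_m) (u v : 'cV[R[i]]_m) :
  (forall n, 0 < r n < 1) -> (forall n, sqbound 1 (F n)) -> 0 <= C ->
  (forall n, sqbound C (D n)) ->
  cvgn (fun N => rdot (ncsum r F D N *m u) v).
Proof.
move=> hr hF C0 hD.
have -> : (fun N => rdot (ncsum r F D N *m u) v)
  = series (fun n => rdot (ncterm r F D n *m u) v).
  by apply/funext => N; rewrite /ncsum mulmx_suml rdot_suml.
(* Absolute convergence: the partial sums of the absolute values are monotone and bounded. *)
apply: (@normed_cvg R R^o); apply: nondecreasing_is_cvgn.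
  by apply: nondecreasing_series => n _ _ /=; exact: normr_ge0.
exists ((C * rdot u u + rdot v v) / 2) => _ [N _ <-].
exact: ncterm_dot_summable.
Qed.

Lemma ncsum_cvg (R : realType) (m : nat) (r : nat -> R) (C : R)
    (F D : nat -> 'M[R[i]]_m) :
  (forall n, 0 < r n < 1) -> (forall n, sqbound 1 (F n)) -> 0 <= C ->
  (forall n, sqbound C (D n)) ->
  mxcvg (ncsum r F D) (mxlim (ncsum r F D)).
Proof.
move=> hr hF C0 hD i j; rewrite mxE; split => /=.
  under eq_fun do rewrite -rdot_delta_Re; exact: (ncsum_dot_cvg hr hF C0 hD).
under eq_fun do rewrite -rdot_delta_Im; exact: (ncsum_dot_cvg hr hF C0 hD).
Qed.

Lemma ncsum_lim_bound (R : realType) (m : nat) (r : nat -> R) (C : R)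
    (F D : nat -> 'M[R[i]]_m) :
  (forall n, 0 < r n < 1) -> (forall n, sqbound 1 (F n)) -> 0 <= C ->
  (forall n, sqbound C (D n)) ->
  sqbound C (mxlim (ncsum r F D)).
Proof.
move=> hr hF C0 hD; apply: mxcvg_sqbound (ncsum_cvg hr hF C0 hD) _ => N.
exact: ncterm_sum_bound.
Qed.

Lemma ncsum_lim_intertwine (R : realType) (m n : nat) (r : nat -> R) (C : R)
    (F1 D1 : nat -> 'M[R[i]]_m) (F2 D2 : nat -> 'M[R[i]]_n)
    (T : 'M[R[i]]_(n, m)) :
  (forall j, 0 < r j < 1) -> 0 <= C ->
  (forall j, sqbound 1 (F1 j)) -> (forall j, sqbound C (D1 j)) ->
  (forall j, sqbound 1 (F2 j)) -> (forall j, sqbound C (D2 j)) ->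
  (forall j, T *m F1 j = F2 j *m T) -> (forall j, T *m D1 j = D2 j *m T) ->
  T *m mxlim (ncsum r F1 D1) = mxlim (ncsum r F2 D2) *m T.
Proof.
move=> hr C0 hF1 hD1 hF2 hD2 hF hD.
have h1 := mxcvg_mull T (ncsum_cvg hr hF1 C0 hD1).
have h2 := mxcvg_mulr T (ncsum_cvg hr hF2 C0 hD2).
(* Both sides are limits of the same sequence, since every term intertwines. *)
rewrite -(mxcvg_lim h1) -(mxcvg_lim h2); congr (mxlim _); apply/funext => N.
rewrite /ncsum mulmx_sumr mulmx_suml; apply: eq_bigr => k _.
exact: ncterm_intertwine.
Qed.

Lemma rdot_col_mx (R : realType) (m n : nat) (u : 'cV[R[i]]_m)
    (v : 'cV[R[i]]_n) :
  rdot (col_mx u v) (col_mx u v) = rdot u u + rdot v v.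
Proof.
rewrite !rdotE big_split_ord /=; congr (_ + _); apply: eq_bigr => k _.
  by rewrite col_mxEu.
by rewrite col_mxEd.
Qed.

Lemma sqbound_block (R : realType) (m n : nat) (C : R) (A : 'M[R[i]]_m)
    (B : 'M[R[i]]_n) :
  sqbound C A -> sqbound C B -> sqbound C (block_mx A 0 0 B).
Proof.
move=> hA hB v; rewrite -[v]vsubmxK mul_block_col !mul0mx addr0 add0r.
by rewrite !rdot_col_mx mulrDr lerD.
Qed.

Lemma ncsum_lim_block (R : realType) (m n : nat) (r : nat -> R) (C : R)
    (F1 D1 : nat -> 'M[R[i]]_m) (F2 D2 : nat -> 'M[R[i]]_n) :
  (forall j, 0 < r j < 1) -> 0 <= C ->
  (forall j, sqbound 1 (F1 j)) -> (forall j, sqbound C (D1 j)) ->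
  (forall j, sqbound 1 (F2 j)) -> (forall j, sqbound C (D2 j)) ->
  mxlim (ncsum r (fun j => block_mx (F1 j) 0 0 (F2 j))
                 (fun j => block_mx (D1 j) 0 0 (D2 j)))
  = block_mx (mxlim (ncsum r F1 D1)) 0 0 (mxlim (ncsum r F2 D2)).
Proof.
move=> hr C0 hF1 hD1 hF2 hD2.
have hF j := sqbound_block (hF1 j) (hF2 j).
have hD j := sqbound_block (hD1 j) (hD2 j).
set L := mxlim _.
(* Each coordinate projection intertwines the block family with one of its blocks; the two
   identities determine the two block rows of [L]. *)
have e1 : row_mx 1%:M 0 *m L = mxlim (ncsum r F1 D1) *m row_mx 1%:M 0.
  apply: (ncsum_lim_intertwine hr C0 hF hD hF1 hD1) => j;
  by rewrite mul_row_block mul_mx_row !mul1mx !mul0mx mulmx1 mulmx0 !addr0.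
have e2 : row_mx 0 1%:M *m L = mxlim (ncsum r F2 D2) *m row_mx 0 1%:M.
  apply: (ncsum_lim_intertwine hr C0 hF hD hF2 hD2) => j;
  by rewrite mul_row_block mul_mx_row !mul1mx !mul0mx mulmx1 mulmx0 !add0r.
rewrite -[L]mul1mx scalar_mx_block /block_mx mul_col_mx e1 e2 !mul_mx_row.
by rewrite !mulmx1 !mulmx0.
Qed.

(** * The operator norm in terms of [sqbound] *)

Lemma euclnorm_sqr (R : realType) (m : nat) (v : 'cV[R[i]]_m) :
  euclnorm v ^+ 2 = rdot v v.
Proof.
rewrite /euclnorm sqr_sqrtr; last by apply: sumr_ge0 => k _; exact: sqr_ge0.
rewrite rdotE; apply: eq_bigr => k _; case: (v k 0) => a b /=.
by rewrite sqr_sqrtr ?addr_ge0 ?sqr_ge0 // !expr2.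
Qed.

Lemma euclnorm_le (R : realType) (m : nat) (v : 'cV[R[i]]_m) (C : R) :
  0 <= C -> (euclnorm v <= C) = (rdot v v <= C ^+ 2).
Proof.
by move=> C0; rewrite -euclnorm_sqr ler_pXn2r // nnegrE ?sqrtr_ge0.
Qed.

Lemma sqboundD (R : realType) (m : nat) (C1 C2 : R) (A B : 'M[R[i]]_m) :
  sqbound C1 A -> sqbound C2 B -> sqbound (2 * (C1 + C2)) (A + B).
Proof.
move=> hA hB v; rewrite mulmxDl rdotDD.
have := le_trans (ler_norm _) (rdot_amgm (A *m v) (B *m v)).
have := hA v; have := hB v; lra.
Qed.

(** Expand in elementary matrices; each has the squared modulus of its coefficient as bound. This
    makes the supremum in [opnorm] a genuine one. *)
Lemma sqbound_exists (R : realType) (m : nat) (A : 'M[R[i]]_m) :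
  exists2 C : R, 0 <= C & sqbound C A.
Proof.
rewrite [A]matrix_sum_delta.
elim/big_ind: _ => [||i _].
- by exists 0 => // v; rewrite mul0mx rdot0l mul0r.
- move=> B1 B2 [C1 C10 h1] [C2 C20 h2]; exists (2 * (C1 + C2)).
    by rewrite mulr_ge0 // addr_ge0.
  exact: sqboundD.
elim/big_ind: _ => [||j _].
- by exists 0 => // v; rewrite mul0mx rdot0l mul0r.
- move=> B1 B2 [C1 C10 h1] [C2 C20 h2]; exists (2 * (C1 + C2)).
    by rewrite mulr_ge0 // addr_ge0.
  exact: sqboundD.
exists (complex.Re (A i j) ^+ 2 + complex.Im (A i j) ^+ 2).
  by rewrite addr_ge0 ?sqr_ge0.
move=> v; rewrite -scalemxAl rdotE (bigD1 i) //= big1 => [|k ki].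
  rewrite !mxE (bigD1 j) //= big1 => [|k kj]; last first.
    by rewrite mxE (negbTE kj) andbF mul0r.
  rewrite !mxE !eqxx mul1r addr0 addr0 rdotE (bigD1 j) //= mulrDr.
  rewrite -[leLHS]addr0 lerD //.
    by case: (A i j) (v j 0) => a b [c e] /=; rewrite le_eqVlt; apply/orP; left;
      apply/eqP; ring.
  rewrite mulr_ge0 ?addr_ge0 ?sqr_ge0 // sumr_ge0 // => k _.
  by rewrite addr_ge0 // -expr2 sqr_ge0.
rewrite !mxE big1 => [|l _]; last by rewrite mxE (negbTE ki) mul0r.
by rewrite mulr0 /= !mulr0 addr0.
Qed.

Lemma opnorm_ubound (R : realType) (m : nat) (A : 'M[R[i]]_m) :
  has_ubound [set euclnorm (A *m v) |
    v in [set v : 'cV[R[i]]_m | euclnorm v <= 1]].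
Proof.
have [C C0 hC] := sqbound_exists A; exists (C + 1) => _ [v /= hv <-].
rewrite euclnorm_le ?addr_ge0 //; apply: le_trans (hC v) _.
move: hv; rewrite euclnorm_le // expr1n; have := rdot_ge0 v; nra.
Qed.

Lemma opnorm_ge0 (R : realType) (m : nat) (A : 'M[R[i]]_m) : 0 <= opnorm A.
Proof.
apply: le_trans (sqrtr_ge0 _) (ub_le_sup (opnorm_ubound A) _).
exists 0 => //=; by rewrite euclnorm_le // rdot0l expr1n.
Qed.

Lemma opnorm_le (R : realType) (m : nat) (A : 'M[R[i]]_m) (C : R) :
  0 <= C -> sqbound (C ^+ 2) A -> opnorm A <= C.
Proof.
move=> C0 hA; apply: ge_sup.
  exists (euclnorm (A *m 0)), 0 => //=; by rewrite euclnorm_le // rdot0l expr1n.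
move=> _ [v /= hv <-]; rewrite euclnorm_le //; apply: le_trans (hA v) _.
by move: hv; rewrite euclnorm_le // expr1n => hv; rewrite ler_piMr ?sqr_ge0.
Qed.

Lemma sqbound_opnorm (R : realType) (m : nat) (A : 'M[R[i]]_m) (C : R) :
  opnorm A <= C -> sqbound (C ^+ 2) A.
Proof.
move=> hC v; have C0 := le_trans (opnorm_ge0 A) hC.
have [v0|v0] := leP (rdot v v) 0.
  by rewrite (rdot_eq0 v0) mulmx0 !rdot0l mulr0.
have e0 : 0 < euclnorm v.
  by rewrite lt_neqAle sqrtr_ge0 andbT eq_sym -sqrf_eq0 euclnorm_sqr gt_eqF.
(* The supremum only sees the unit ball, so [v] is rescaled to norm one. *)
have : euclnorm (A *m ((euclnorm v)^-1%:C *: v)) <= C.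
  apply: le_trans hC; apply: ub_le_sup (opnorm_ubound A) _ _.
  exists ((euclnorm v)^-1%:C *: v) => //=.
  by rewrite euclnorm_le // rdotZ -euclnorm_sqr -exprMn mulVf ?gt_eqF.
by rewrite euclnorm_le // -scalemxAr rdotZ exprVn euclnorm_sqr mulrC ler_pdivrMr.
Qed.

Lemma opnorm1_ge1 (R : realType) (m : nat) :
  (0 < m)%N -> 1 <= opnorm (1%:M : 'M[R[i]]_m).
Proof.
case: m => // m _; set e : 'cV[R[i]]_m.+1 := delta_mx 0 0.
have ee : rdot e e = 1.
  by have := rdot_delta_Re (1%:M : 'M[R[i]]_m.+1) 0 0; rewrite mul1mx mxE.
have en : euclnorm e = 1.
  by apply/eqP; rewrite -(@eqrXn2 _ 2) ?sqrtr_ge0 // euclnorm_sqr ee expr1n.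
apply: ub_le_sup (opnorm_ubound _) _ _; exists e => /=; first by rewrite en.
by rewrite mul1mx.
Qed.

Lemma opnorm_hnorm (R : realType) (d : option nat) (f : graded_map R d)
    (m : nat) (X : mxtuple R d m) :
  Hinfty f -> ncball X -> opnorm (f m X) <= hnorm f.
Proof. by move=> [_ hf] hX; apply: ub_le_sup => //; exists m, X. Qed.

(** * Values at the nodes *)

Lemma kleft0 (R : realType) (m : nat) (r : nat -> R)
    (F : nat -> 'M[R[i]]_m) n :
  (forall j, (j < n)%N -> F j = 0) ->
  kleft r F n = (\prod_(0 <= j < n) Num.sqrt (r j))%:C%:M.
Proof.
elim: n => [|n IH] h /=; first by rewrite big_nil.
rewrite IH => [|j jn]; last by rewrite h // ltnW.
by rewrite h // kmx0 -scalar_mxM -rmorphM big_nat_recr.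
Qed.

Lemma kright0 (R : realType) (m : nat) (r : nat -> R)
    (F : nat -> 'M[R[i]]_m) n :
  (forall j, (j < n)%N -> F j = 0) ->
  kright r F n = (\prod_(0 <= j < n) Num.sqrt (r j))%:C%:M.
Proof.
elim: n => [|n IH] h /=; first by rewrite big_nil.
rewrite IH => [|j jn]; last by rewrite h // ltnW.
by rewrite h // kmx0 -scalar_mxM -rmorphM big_nat_recr //= mulrC.
Qed.

(** The scalar [c_n], the common value of [A_n] and [B_n] at [Z_n]. *)
Definition weight (R : realType) (r : nat -> R) (n : nat) : R :=
  (\prod_(0 <= j < n) Num.sqrt (r j)) * (r n / (1 + r n)).

Lemma weight_gt0 (R : realType) (r : nat -> R) (n : nat) :
  (forall j, 0 < r j < 1) -> 0 < weight r n.
Proof.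
move=> hr; have h j : 0 < r j by case/andP: (hr j).
by rewrite mulr_gt0 ?prodr_gt0 ?divr_gt0 ?addr_gt0 // => j _; rewrite sqrtr_gt0.
Qed.

Lemma ncsum_node (R : realType) (m : nat) (r : nat -> R)
    (F D : nat -> 'M[R[i]]_m) (n : nat) (A : 'M[R[i]]_m) :
  (forall j, 0 < r j < 1) -> F n = (r n)%:C%:M ->
  (forall j, j != n -> F j = 0) -> D n = (weight r n ^- 2)%:C *: A ->
  mxlim (ncsum r F D) = A.
Proof.
move=> hr hn h0 hD; have w0 := weight_gt0 n hr.
(* The partial sums are constant from [n.+1] on: [h(0) = 0] kills every term of index other than
   [n]. *)
apply: mxcvg_lim; apply: (@mxcvg_near _ _ _ _ _ n.+1) => N nN.
rewrite /ncsum (big_cat_nat (n := n.+1)) //= big_nat_recr //=.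
rewrite !big_nat big1 => [|j /andP[_ jn]]; last first.
  by rewrite /ncterm /colfun h0 ?hmx0 ?mul0mx ?mulmx0 // ltn_eqF.
rewrite [X in _ + X]big1 => [|j /andP[jn _]]; last first.
  by rewrite /ncterm /colfun h0 ?hmx0 ?mul0mx ?mulmx0 // gtn_eqF.
have h0' j : (j < n)%N -> F j = 0 by move=> jn; rewrite h0 // ltn_eqF.
rewrite add0r addr0 /ncterm /rowfun /colfun kleft0 // kright0 // hn.
rewrite hmx_scalar //.
rewrite -!scalar_mxM -!rmorphM [_ * \prod_(_ <= _ < _) _]mulrC -/(weight r n).
rewrite hD mul_scalar_mx scalerA mul_mx_scalar scalerA -!rmorphM /=.
by rewrite mulrA -expr2 mulfV ?scale1r // expf_neq0 // gt_eqF.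
Qed.

(** * Bounds on [rho_nc] and almost extremal separators *)

(** The value at [W] is the identity of a nonzero space. Hence the infimum in [rho_nc] is at least 1
    and its inverse is genuine. *)
Lemma separators_ge1 (R : realType) (d : option nat) (k : nat)
    (W : mxtuple R d k) (m : nat -> nat) (J : set nat)
    (Wj : forall j, mxtuple R d (m j)) (phi : graded_map R d) :
  ncball W -> separators W J Wj phi -> 1 <= hnorm phi.
Proof.
move=> hW [hphi h1 _]; apply: le_trans (opnorm_hnorm hphi hW).
by rewrite h1 opnorm1_ge1 //; case: hW => -[].
Qed.

Lemma rho_nc_bounds (R : realType) (d : option nat) (k : nat)
    (W : mxtuple R d k) (m : nat -> nat) (J : set nat)
    (Wj : forall j, mxtuple R d (m j)) :
  ncball W -> 0 <= rho_nc W J Wj <= 1.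
Proof.
move=> hW; rewrite /rho_nc.
case: asboolP => [[phi hphi]|_]; last by rewrite lexx ler01.
set I := inf _; have I1 : 1 <= I.
  apply: lb_le_inf; first by exists (hnorm phi), phi.
  by move=> _ [psi hpsi <-]; exact: separators_ge1 hpsi.
have I0 : 0 < I by exact: lt_le_trans I1.
by rewrite invr_ge0 ltW //= invf_le1.
Qed.

(** The infimum may not be attained; the strict inequality [s < rho_nc W J Wj] leaves room for a
    separator of norm below [s^-1]. *)
Lemma rho_nc_separator (R : realType) (d : option nat) (k : nat)
    (W : mxtuple R d k) (m : nat -> nat) (J : set nat)
    (Wj : forall j, mxtuple R d (m j)) (s : R) :
  ncball W -> 0 < s < rho_nc W J Wj ->
  exists2 phi : graded_map R d, separators W J Wj phi & s * hnorm phi <= 1.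
Proof.
move=> hW /andP[s0]; rewrite /rho_nc.
case: asboolP => [[phi hphi]|_]; last first.
  by move=> /(lt_trans s0); rewrite ltxx.
set I := inf _; have I1 : 1 <= I.
  apply: lb_le_inf; first by exists (hnorm phi), phi.
  by move=> _ [psi hpsi <-]; exact: separators_ge1 hpsi.
have I0 : 0 < I by exact: lt_le_trans I1.
move=> sI; have : I < s^-1 by rewrite -[I]invrK ltf_pV2 // posrE invr_gt0.
move=> /inf_lt[|_ [psi hpsi <-] hlt]; first by exists (hnorm phi), phi.
by exists psi => //; rewrite mulrC -ler_pdivlMr // div1r ltW.
Qed.

(** * Shrinking the factors of a convergent product *)

Lemma prod_le_last (R : realType) (u : nat -> R) (n : nat) :
  (forall j, 0 <= u j <= 1) -> \prod_(0 <= j < n.+1) u j <= u n.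
Proof.
move=> hu; rewrite big_nat_recr //= ler_piMl //; first by case/andP: (hu n).
suff /andP[] : 0 <= \prod_(0 <= j < n) u j <= 1 by [].
elim: n => [|n /andP[IH0 IH1]]; first by rewrite big_nil ler01 lexx.
by case/andP: (hu n) => u0 u1; rewrite big_nat_recr //= mulr_ge0 // mulr_ile1.
Qed.

(* The factor [q n.+1 / q n] makes [r n] strictly smaller than [rho n], at the
   cost of at most [1/2] in every partial product. *)
Lemma shrink_product (R : realType) (rho : nat -> R) :
  (forall n, 0 <= rho n <= 1) -> 0 < limn (fun N => \prod_(0 <= n < N) rho n) ->
  exists r : nat -> R, exists2 e : R, 0 < e &
    forall n, [/\ 0 < r n < 1, r n < rho n & e <= weight r n].
Proof.
move=> hrho L0; set L := limn _ in L0.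
have pr0 N : 0 <= \prod_(0 <= n < N) rho n.
  by apply: prodr_ge0 => n _; case/andP: (hrho n).
have LN N : L <= \prod_(0 <= n < N) rho n.
  have ni : nonincreasing_seq (fun N => \prod_(0 <= n < N) rho n).
    apply/nonincreasing_seqP => k; rewrite big_nat_recr //=.
    by rewrite ler_piMr //; case/andP: (hrho k).
  apply: (nonincreasing_cvgn_ge ni); apply: nonincreasing_is_cvgn => //.
  by exists 0 => _ [k _ <-].
have Lrho n : L <= rho n.
  by apply: le_trans (LN n.+1) _; exact: prod_le_last.
(* [q] decreases strictly from [q 0 = 1] and stays above [1/2]; the ratios [q n.+1 / q n] telescope
   to [q N]. *)
pose q n : R := (1 + n.+1%:R^-1) / 2.
have q_gt n : 2^-1 < q n.
  by rewrite /q ltr_pdivlMr // mulVf // ltrDl invr_gt0 ltr0n.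
have q_dec n : q n.+1 < q n.
  by rewrite /q ltr_pM2r ?invr_gt0 // ltrD2l ltf_pV2 ?posrE ?ltr0n // ltr_nat.
have q0 n : 0 < q n by apply: lt_trans (q_gt n); rewrite invr_gt0.
pose r n := rho n * (q n.+1 / q n).
have rho0 n : 0 < rho n by exact: lt_le_trans (Lrho n).
have t1 n : q n.+1 / q n < 1 by rewrite ltr_pdivrMr // mul1r.
have r_rho n : r n < rho n by rewrite gtr_pMr.
have r0 n : 0 < r n by rewrite mulr_gt0 // divr_gt0.
have rle1 n : r n < 1 by apply: lt_le_trans (r_rho n) _; case/andP: (hrho n).
have prodr N : \prod_(0 <= n < N) r n = (\prod_(0 <= n < N) rho n) * q N.
  elim: N => [|N IH]; first by rewrite !big_nil mul1r /q invr1 divff.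
  rewrite !big_nat_recr //= IH /r mulrACA; congr (_ * _).
  by rewrite mulrC divfK // gt_eqF.
have Lr N : L / 2 <= \prod_(0 <= n < N) r n.
  by rewrite prodr ler_pM // ?ltW // invr_ge0.
(* Since [sqrt r_j >= r_j], the product of the roots is at least [L / 2]; and [r_n >= L / 2] with
   [1 + r_n <= 2] bounds [r_n / (1 + r_n)] below by [L / 2 / 2]. *)
exists r, (L / 2 * (L / 2 / 2)); first by rewrite !mulr_gt0 ?invr_gt0.
move=> n; split; [by rewrite r0 rle1 | by [] |].
have rL : L / 2 <= r n.
  apply: le_trans (Lr n.+1) _; apply: prod_le_last => j.
  by rewrite !ltW.
rewrite /weight; apply: ler_pM; rewrite ?mulr_ge0 ?invr_ge0 ?(ltW L0) //.
  apply: le_trans (Lr n) _; apply: ler_prod => j _; rewrite (ltW (r0 j)) /=.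
  rewrite -[leLHS](sqr_sqrtr (ltW (r0 j))) expr2 ler_piMl ?sqrtr_ge0 //.
  by rewrite -sqrtr1 ler_sqrt // ltW.
apply: ler_pM; rewrite ?mulr_ge0 ?invr_ge0 ?(ltW L0) //.
by rewrite lef_pV2 ?posrE ?addr_gt0 // -[2]/(1 + 1) lerD2l ltW.
Qed.


Unset Implicit Arguments.

Theorem theorem1p15 (R : realType) (d : option nat) (m : nat -> nat)
    (Z : forall n, mxtuple R d (m n))
    (hZ : forall n, ncball (Z n))
    (hprod : 0 < limn (fun N : nat =>
       \prod_(0 <= n < N) rho_nc (Z n) [set j : nat | j != n] Z)) :
  interpolating Z.
Proof.
have [r [e e0 hr]] := shrink_product (fun n => rho_nc_bounds _ _ (hZ n)) hprod.
have r01 n : 0 < r n < 1 by case: (hr n).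
have r0 n : 0 < r n by case/andP: (r01 n).
have /choice[psi hpsi] n : exists f : graded_map R d,
    separators (Z n) [set j : nat | j != n] Z f /\ r n * hnorm f <= 1.
  have [_ rn _] := hr n.
  have [|f hf rf] := rho_nc_separator (Wj := Z) (J := [set j | j != n])
    (s := r n) (hZ n).
    by rewrite r0.
  by exists f.
have psiH n : Hinfty (psi n) by case: (hpsi n) => -[].
move=> phi_ hphi [M hM].
have M0 : 0 <= M.
  apply: le_trans (hM 0%N); apply: le_trans (opnorm_hnorm (hphi 0%N) (hZ 0%N)).
  exact: opnorm_ge0.
(* As [e <= weight r n], the norm of every [D k X n] is at most [e ^- 2 * M]; the square is the form
   that [sqbound] takes. *)
pose C := (e ^- 2 * M) ^+ 2.
have C0 : 0 <= C by exact: sqr_ge0.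
pose F k (X : mxtuple R d k) n := (r n)%:C *: psi n _ X.
pose D k (X : mxtuple R d k) n := (weight r n ^- 2)%:C *: phi_ n _ X.
have hF k (X : mxtuple R d k) : ncball X -> forall n, sqbound 1 (F k X n).
  move=> hX n v; rewrite /F -scalemxAl rdotZ.
  have := sqbound_opnorm (opnorm_hnorm (psiH n) hX) v.
  move=> /(ler_wpM2l (sqr_ge0 (r n)))/le_trans; apply.
  rewrite mulrA -exprMn ler_wpM2r ?rdot_ge0 // exprn_ile1 //;
    last by case: (hpsi n).
  rewrite mulr_ge0 ?(ltW (r0 n)) //.
  exact: le_trans (opnorm_ge0 _) (opnorm_hnorm (psiH n) hX).
have hD k (X : mxtuple R d k) : ncball X -> forall n, sqbound C (D k X n).
  move=> hX n v; rewrite /D -scalemxAl rdotZ.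
  have := sqbound_opnorm (le_trans (opnorm_hnorm (hphi n) hX) (hM n)) v.
  move=> /(ler_wpM2l (sqr_ge0 (weight r n ^- 2)))/le_trans; apply.
  rewrite mulrA -exprMn ler_wpM2r ?rdot_ge0 // /C.
  have w0 := weight_gt0 n r01.
  rewrite ler_pXn2r ?nnegrE ?mulr_ge0 ?invr_ge0 ?sqr_ge0 // ler_wpM2r //.
  rewrite lef_pV2 ?posrE ?exprn_gt0 // ler_pXn2r ?nnegrE ?(ltW e0) ?(ltW w0) //.
  by case: (hr n).
(* Outside the ball the limit may be a default value; only points of the ball matter. *)
pose phi : graded_map R d := fun k X => mxlim (ncsum r (F k X) (D k X)).
have phi_le k (X : mxtuple R d k) : ncball X -> opnorm (phi k X) <= e ^- 2 * M.
  move=> hX; apply: opnorm_le.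
    by rewrite mulr_ge0 ?invr_ge0 ?sqr_ge0.
  exact: (ncsum_lim_bound r01 (hF _ _ hX) C0 (hD _ _ hX)).
exists phi; last first.
  (* At [Z n] the contraction of index [n] is the scalar [r n] and all others vanish, so the series
     reduces to its term of index [n]. *)
  move=> n; apply: (ncsum_node r01 (n := n)) => //.
    by rewrite /F; case: (hpsi n) => -[_ -> _] _; rewrite scalemx1.
  move=> j jn; rewrite /F; case: (hpsi j) => -[_ _ h] _.
  by rewrite h ?scaler0 //= eq_sym.
split; last first.
  by exists (e ^- 2 * M) => _ [k [X hX ->]]; exact: phi_le.
split; last first.
  (* The bound is global, so the whole space serves as neighbourhood. *)
  move=> k X hX; exists (fun _ _ => True); split => //.
    by move=> ? ? ? _; exists 1.
  by exists (e ^- 2 * M) => j Y hY _; exact: phi_le.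
split=> [k l X Y hX hY|k P X Pu hX hPX].
  have hb (f : graded_map R d) (a : R) : Hinfty f ->
      a%:C *: f _ (dsum X Y) = block_mx (a%:C *: f _ X) 0 0 (a%:C *: f _ Y).
    by move=> [[[h _] _] _]; rewrite h // scale_block_mx !scaler0.
  have eF : F _ (dsum X Y) = fun n => block_mx (F _ X n) 0 0 (F _ Y n).
    by apply/funext => n; exact: hb (psiH n).
  have eD : D _ (dsum X Y) = fun n => block_mx (D _ X n) 0 0 (D _ Y n).
    by apply/funext => n; exact: hb (hphi n).
  rewrite /phi eF eD; apply: (ncsum_lim_block r01 C0); first exact: hF.
  - exact: hD.
  - exact: hF.
  - exact: hD.
have hs (f : graded_map R d) (a : R) : Hinfty f ->
    P *m (a%:C *: f _ (Defs.similar P X)) = (a%:C *: f _ X) *m P.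
  move=> [[[_ h] _] _]; rewrite h // -scalemxAr -scalemxAl -mulmxA.
  by rewrite mulKVmx.
(* Cancelling [invmx P] leaves the intertwining relation with [T = P], between the values at
   [P^-1 X P] and at [X]. *)
rewrite -mulmxA -[LHS](mulKmx Pu); congr (_ *m _).
by apply: (ncsum_lim_intertwine r01 C0 (hF _ _ hPX) (hD _ _ hPX) (hF _ _ hX)
  (hD _ _ hX)) => n; [exact: hs (psiH n) | exact: hs (hphi n)].
Qed.
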